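(* Let $n \geqslant 3$ be an integer and let $\mathcal{X}$ be a set of $n$ points in the Euclidean plane $\mathbb{R}^2$, not all lying on one line. Suppose there exist a point $A \in \mathbb{R}^2$ (not required to belong to $\mathcal{X}$) and three distinct lines $p, q, r$ in $\mathbb{R}^2$, all passing through $A$, such that $\mathcal{X} \subseteq p \cup q \cup r$. Then $\mathcal{X}$ has an ordinary point, i.e. there is a point $P \in \mathcal{X}$ that is incident with at least $\lceil \frac{n}{2} \rceil$ lines spanned by $\mathcal{X}$.
   Context: A line is spanned by $\mathcal{X}$ if it passes through at least two distinct points of $\mathcal{X}$. A point of $\mathcal{X}$, where $|\mathcal{X}| = n$, is called an ordinary point if it is incident with at least $\lceil \frac{n}{2} \rceil$ distinct lines spanned by $\mathcal{X}$. *)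

(* Defs.v *)
From mathcomp Require Import all_boot all_order all_algebra.
From mathcomp Require Import classical_sets functions cardinality reals.

Set Implicit Arguments.
Unset Strict Implicit.
Unset Printing Implicit Defensive.

Import Order.TTheory GRing.Theory Num.Theory.
Local Open Scope classical_set_scope.
Local Open Scope ring_scope.
Local Open Scope card_scope.

Definition is_line (R : realType) (L : set 'rV[R]_2) : Prop :=
  exists A v : 'rV[R]_2, v != 0 /\ L = [set A + t *: v | t in [set: R]].

Definition spanned_line (R : realType) (X L : set 'rV[R]_2) : Prop :=
  is_line L /\ exists P Q, [/\ X P, X Q, P != Q, L P & L Q].

(* Meant for X with exactly n points; uphalf n is the ceiling of n / 2, and
   lines are compared as point sets, so distinct lines are counted once. *)
Definition ordinary_point (R : realType) (n : nat) (X : set 'rV[R]_2)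
    (P : 'rV[R]_2) : Prop :=
  X P /\ `I_(uphalf n) #<= [set L | spanned_line X L /\ L P].

(* Main.v *)
Require Import Defs.
From mathcomp Require Import all_boot all_order all_algebra.
From mathcomp Require Import classical_sets functions cardinality reals.
From mathcomp Require Import boolp finmap ring lra zify.
Import Order.TTheory GRing.Theory Num.Theory.
Local Open Scope classical_set_scope.
Local Open Scope ring_scope.
Local Open Scope card_scope.

(** Let [a <= b, c] be the numbers of points of [X] other than [A] on [p], [q]
    and [r], where [p] is a line carrying the fewest of them.  An ordinary
    point is found among two points [y] on [q] and [z] on [r].

    Sending [p] to infinity turns [q] and [r] into parallel lines, on which
    [h x = 1 / (signed distance from x to p)] is an affine coordinate with the
    same scale on both.  A point [x] of [p] becomes a direction, so for all
    chords [y z] from [q] to [r] passing through [x] the difference [h z - h y]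
    is the same ([exists_height]).  Take [y] and [z] to be the points of [X]
    with the largest [h] on [q] and on [r].  If a point [x] of [p] is aligned
    both with [y] and some [z'] on [r], and with [z] and some [y'] on [q], then
    [h z' - h y = h z - h y'] with [h z' <= h z] and [h y' <= h y]; hence
    [h z' = h z], so that [z' = z] and [x] lies on the line [y z]
    ([exists_extreme_pair]).  At most one point of [p] has this property.

    The point [y] sees in distinct directions the [c] points of [r], the points
    of [p] that are not aligned with it and a point of [r], and one further
    point of [q] if there is one ([degree_bound]); likewise for [z].  As at
    most one point of [p] is lost for both, the degrees of [y] and [z] add up
    to at least [a + b + c - 1] plus the contributions of the lines [q] and [r]
    themselves.  If [A] belongs to [X], both lines contribute, and the sum is
    at least [n].  Otherwise it is at least [n] unless a point of [p] is lost
    twice and [q] and [r] each carry a single point; then [a = 1] too and [X]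
    consists of three points of one line, which is excluded.  So one of the two
    degrees is at least [n / 2]. *)

Section ThreeConcurrentLines.
Set Implicit Arguments.
Unset Strict Implicit.
Context {R : realType}.
Implicit Types (P Q T A x y z u v w : 'rV[R]_2) (L M : set 'rV[R]_2).

(** * Collinearity in coordinates *)

Lemma row2P x y : x 0 0 = y 0 0 -> x 0 1 = y 0 1 -> x = y.
Proof.
move=> e0 e1; apply/rowP => i.
case: i => [[|[|//]] Hi].
- by have -> : Ordinal Hi = 0 by apply: val_inj.
- by have -> : Ordinal Hi = 1 by apply: val_inj.
Qed.

Definition cross x y : R := x 0 0 * y 0 1 - x 0 1 * y 0 0.

Definition coll P Q T : bool := cross (Q - P) (T - P) == 0.

Lemma cross_eq0P v x : v != 0 -> cross v x = 0 -> exists t, x = t *: v.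
Proof.
rewrite /cross => v0 vx.
have [v00|v00] := eqVneq (v 0 0) 0; last first.
  exists (x 0 0 / v 0 0); apply: row2P; rewrite !mxE; first by field.
  apply: (mulfI v00); rewrite (_ : v 0 0 * x 0 1 = v 0 1 * x 0 0); last by lra.
  by field.
have [v01|v01] := eqVneq (v 0 1) 0.
  by case/eqP: v0; apply: row2P; rewrite mxE.
exists (x 0 1 / v 0 1); apply: row2P; rewrite !mxE; last by field.
apply: (mulfI v01); rewrite (_ : v 0 1 * x 0 0 = v 0 0 * x 0 1); last by lra.
by field.
Qed.

Lemma collC P Q T : coll P Q T = coll P T Q.
Proof.
rewrite /coll -oppr_eq0; congr (_ == 0).
by rewrite /cross; ring.
Qed.

Lemma coll_rot P Q T : coll P Q T = coll Q T P.
Proof. by rewrite /coll; congr (_ == 0); rewrite /cross !mxE; ring. Qed.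

Lemma line_coll L P Q : is_line L -> L P -> L Q -> P != Q ->
  forall T, L T <-> coll P Q T.
Proof.
move=> [B [v [v0 ->]]] [s _ <-] [t _ <-] PQ T.
have ts : t - s != 0.
  by apply: contra PQ; rewrite subr_eq0 => /eqP->.
split=> [[k _ <-]|/eqP c].
  by apply/eqP; rewrite /cross !mxE; ring.
have [||k ek] := @cross_eq0P v (T - (B + s *: v)) => //.
  by apply: (mulfI ts); rewrite mulr0 -[RHS]c /cross !mxE; ring.
by exists (s + k) => //; rewrite scalerDl addrA -ek addrC subrK.
Qed.

Lemma line_ext L M P Q : is_line L -> is_line M -> P != Q ->
  L P -> L Q -> M P -> M Q -> L = M.
Proof.
move=> lL lM PQ LP LQ MP MQ; apply/seteqP; split=> T.
  by move=> /(line_coll lL LP LQ PQ)/(line_coll lM MP MQ PQ).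
by move=> /(line_coll lM MP MQ PQ)/(line_coll lL LP LQ PQ).
Qed.

Lemma line_direction L A : is_line L -> L A ->
  exists2 v, v != 0 & L = [set A + t *: v | t in [set: R]].
Proof.
move=> [B [v [v0 ->]]] [s _ <-]; exists v => //.
apply/seteqP; split=> T [t _ <-].
  by exists (t - s) => //; rewrite -addrA -scalerDl [s + _]addrC subrK.
by exists (s + t) => //; rewrite scalerDl addrA.
Qed.

Lemma line_through P Q : P != Q -> exists L, [/\ is_line L, L P & L Q].
Proof.
move=> PQ; exists [set P + t *: (Q - P) | t in [set: R]]; split.
- by exists P, (Q - P); rewrite subr_eq0 eq_sym.
- by exists 0 => //; rewrite scale0r addr0.
- by exists 1 => //; rewrite scale1r addrC subrK.
Qed.

Lemma line_meet L M A x : is_line L -> is_line M -> L <> M ->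
  L A -> M A -> L x -> M x -> x = A.
Proof.
move=> lL lM LM LA MA Lx Mx; apply/eqP; apply: contrapT => /negP xA.
by apply: LM; apply: (@line_ext _ _ x A).
Qed.

Lemma distinct_directions L M A u w : is_line L -> is_line M -> L <> M ->
  u != 0 -> w != 0 ->
  L = [set A + t *: u | t in [set: R]] ->
  M = [set A + t *: w | t in [set: R]] ->
  cross u w != 0.
Proof.
move=> lL lM LM u0 w0 Lu Mw; apply/eqP => /(cross_eq0P u0)[t wt].
have : A + w = A.
  apply: (line_meet lL lM LM).
  - by rewrite Lu; exists 0 => //; rewrite scale0r addr0.
  - by rewrite Mw; exists 0 => //; rewrite scale0r addr0.
  - by rewrite Lu; exists t => //; rewrite wt.
  - by rewrite Mw; exists 1 => //; rewrite scale1r.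
by move=> /eqP; rewrite -subr_eq0 addrC addrA addNr add0r (negPf w0).
Qed.

(** * Counting the spanned lines through a point *)

(** Bounding a degree from below amounts to exhibiting points of [X] that are
    seen from [P] in pairwise distinct directions. *)
Lemma pencil_card (X : set 'rV[R]_2) P (D : seq 'rV[R]_2) :
  X P -> (forall d, d \in D -> X d /\ d != P) ->
  pairwise (fun d e => ~~ coll P d e) D ->
  `I_(size D) #<= [set L | spanned_line X L /\ L P].
Proof.
move=> XP DX Dnc.
pose f i := [set T | coll P (nth P D i) T].
have fline i : (i < size D)%N ->
    [/\ is_line (f i), f i P, f i (nth P D i) & P != nth P D i].
  move=> iD; have [_] := DX _ (mem_nth P iD); rewrite eq_sym => PD.
  have [L [lL LP LD]] := line_through PD.
  have -> : f i = L.
    by apply/seteqP; split=> T /(line_coll lL LP LD PD).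
  by split.
have finj : {in `I_(size D) &, injective f}.
  have nc i j : (i < size D)%N -> (j < size D)%N -> (i < j)%N -> f i <> f j.
    move=> iD jD ij fij; have /negP[] := pairwiseP P Dnc i j iD jD ij.
    by have [_ _ + _] := fline _ jD; rewrite -fij.
  move=> i j /set_mem/= iD /set_mem/= jD fij.
  by apply/eqP; case: ltngtP => // ij; [case: (nc i j)|case: (nc j i)].
rewrite -(card_le_eql (inj_card_eq finj)); apply: subset_card_le.
move=> _ [i /= iD <-]; have [lf fP fD PD] := fline _ iD.
split=> //; split=> //; exists P, (nth P D i); split=> //.
by have [] := DX _ (mem_nth P iD).
Qed.

Definition off (S : seq 'rV[R]_2) A L :=
  [seq x <- S | (x \in L) && (x != A)].

Lemma mem_off S A L x : x \in off S A L <-> [/\ x \in S, L x & x != A].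
Proof.
rewrite mem_filter; split=> [/andP[/andP[/set_mem Lx ->] ->]//|[-> Lx ->]].
by rewrite (mem_set Lx).
Qed.

Definition aligned y (s : seq 'rV[R]_2) x := has (fun z => coll y z x) s.

(** The three summands count lines joining [y] to points of [r], to points of
    [p] not already on one of those lines, and the line [q] itself, which is
    spanned as soon as it carries a second point, possibly [A]. *)
Lemma degree_bound p q r A (S : seq 'rV[R]_2) y : uniq S ->
  is_line p -> is_line q -> is_line r ->
  p <> q -> q <> r -> p A -> q A -> r A ->
  y \in off S A q ->
  `I_(size (off S A r) + count (predC (aligned y (off S A r))) (off S A p)
      + has (fun e => (e \in q) && (e != y)) S)
   #<= [set L | spanned_line [set` S] L /\ L y].
Proof.
move=> uS lp lq lr pq qr pA qA rA /mem_off[yS qy yA].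
set B := predC _; pose e : pred 'rV[R]_2 := fun x => (x \in q) && (x != y).
have py : ~ p y by move=> py; case/eqP: yA; exact: (line_meet lp lq).
have ry : ~ r y by move=> ry; case/eqP: yA; exact: (line_meet lq lr).
(* From a point outside a line, its points are seen in distinct directions. *)
have sep L s : is_line L -> ~ L y -> uniq s -> {in s, forall x, L x} ->
    pairwise (fun d e => ~~ coll y d e) s.
  move=> lL Ly us sL; rewrite uniq_pairwise in us.
  apply: (sub_in_pairwise _ (allss s) us) => /= d f ds fs df.
  apply/negP; rewrite coll_rot => /(line_coll lL (sL _ ds) (sL _ fs) df).
  exact: Ly.
pose D := off S A r ++ filter B (off S A p) ++ take 1 (filter e S).
have -> : (size (off S A r) + count B (off S A p) + has e S)%N = size D.
  rewrite /D !size_cat size_filter addnA; congr addn.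
  by rewrite size_take size_filter has_count; case: (count e S) => [|[]].
have eD x : x \in take 1 (filter e S) -> [/\ x \in S, q x & x != y].
  by move=> /mem_take; rewrite mem_filter => /andP[/andP[/set_mem ? ?] ?].
have qD L x d : is_line L -> L <> q -> L A -> x \in take 1 (filter e S) ->
    d \in off S A L -> ~~ coll y d x.
  move=> lL Lq LA /eD[_ qx xy] /mem_off[_ Ld dA]; apply/negP.
  rewrite eq_sym in xy; rewrite collC => /(line_coll lq qy qx xy) qd.
  by case/eqP: dA; apply: (line_meet lL lq).
apply: pencil_card => [//|d|].
- rewrite !mem_cat => /or3P[/mem_off[dS rd dA]||/eD[]//].
    by split=> //; apply: contraPneq ry => <-.
  rewrite mem_filter => /andP[_ /mem_off[dS pd dA]].
  by split=> //; apply: contraPneq py => <-.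
- rewrite !pairwise_cat allrel_catr -!andbA; do ![apply/andP; split].
  + apply/allrelP => z x zr; rewrite mem_filter => /andP[/hasPn + _].
    by apply.
  + by apply/allrelP => z x zr /(qD r); apply=> //; exact/nesym.
  + apply: (sep r) => //; first exact: filter_uniq.
    by move=> x /mem_off[].
  + apply/allrelP => x f; rewrite mem_filter => /andP[_ xp] /(qD p); exact.
  + apply: (sep p) => //; first by rewrite !filter_uniq.
    by move=> x; rewrite mem_filter => /andP[_ /mem_off[]].
  + by case: (filter e S) => [|? []].
Qed.

(** * The projective height and the extreme pair *)

(** The alignment condition divided by [s * t * k]: it is affine in the
    inverses of the positions of [y], [z] and [x] on their lines. *)
Lemma coll_height A u v w y z x (s t k : R) :
  cross u w != 0 -> cross v w != 0 -> s != 0 -> t != 0 -> k != 0 ->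
  y = A + s *: u -> z = A + t *: v -> x = A + k *: w -> coll y z x ->
  (cross w (z - A))^-1 - (cross w (y - A))^-1 =
  - cross u v / (k * cross u w * cross v w).
Proof.
move=> uw vw s0 t0 k0 -> -> ->; rewrite /coll => /eqP c.
have -> : cross w (A + t *: v - A) = - t * cross v w.
  by rewrite /cross !mxE; ring.
have -> : cross w (A + s *: u - A) = - s * cross u w.
  by rewrite /cross !mxE; ring.
have {c} e : t * k * cross v w - t * s * cross v u - s * k * cross u w = 0.
  by rewrite -[RHS]c /cross !mxE; ring.
have -> : cross u v = - (cross v u) by rewrite /cross; ring.
have d : s * t * k * cross u w * cross v w != 0 by rewrite !mulf_neq0.
apply: (mulfI d); apply/eqP; rewrite -subr_eq0; apply/eqP.
transitivity (t * k * cross v w - t * s * cross v u - s * k * cross u w) => //.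
by field; rewrite s0 t0 k0 uw vw.
Qed.

(** The height is the inverse of the signed distance to [p], that is, the
    affine coordinate along [q] and [r] once [p] has been sent to infinity:
    chords through a fixed point of [p] become parallel. *)
Lemma exists_height p q r A :
  is_line p -> is_line q -> is_line r -> p <> q -> p <> r ->
  p A -> q A -> r A ->
  exists h : 'rV[R]_2 -> R,
    (forall x y y' z z', p x -> x != A -> q y -> y != A -> q y' -> y' != A ->
       r z -> z != A -> r z' -> z' != A -> coll y z x -> coll y' z' x ->
       h z - h y = h z' - h y') /\
    (forall z z', r z -> z != A -> r z' -> z' != A -> h z = h z' -> z = z').
Proof.
move=> lp lq lr pq pr pA qA rA.
have [w w0 pw] := line_direction lp pA.
have [u u0 qu] := line_direction lq qA.
have [v v0 rv] := line_direction lr rA.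
have uw := distinct_directions lq lp (nesym pq) u0 w0 qu pw.
have vw := distinct_directions lr lp (nesym pr) v0 w0 rv pw.
exists (fun P => (cross w (P - A))^-1).
have nz s d : A + s *: d != A -> s != 0.
  by apply: contra_neq => ->; rewrite scale0r addr0.
split.
  move=> x y y' z z'; rewrite pw qu rv => -[k _ <-] /nz k0 [s _ <-] /nz s0.
  move=> [s' _ <-] /nz s'0 [t _ <-] /nz t0 [t' _ <-] /nz t'0 c c'.
  rewrite (coll_height uw vw s0 t0 k0 erefl erefl erefl c).
  by rewrite (coll_height uw vw s'0 t'0 k0 erefl erefl erefl c').
move=> z z'; rewrite rv => -[t _ <-] /nz t0 [t' _ <-] /nz t'0 /invr_inj.
have hE b : cross w (A + b *: v - A) = - b * cross v w.
  by rewrite /cross !mxE; ring.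
by rewrite !hE => /(mulIf vw)/oppr_inj->.
Qed.

Lemma seq_max (T : eqType) (f : T -> R) (s : seq T) : s != [::] ->
  exists2 m, m \in s & {in s, forall x : T, f x <= f m}.
Proof.
elim: s => // a [|b s] IH _.
  by exists a; rewrite ?mem_head// => x; rewrite inE => /eqP->.
have [m ms mmax] := IH isT.
have [am|ma] := leP (f a) (f m).
  exists m; first by rewrite inE ms orbT.
  by move=> x; rewrite inE => /orP[/eqP->//|/mmax].
exists a; first exact: mem_head.
by move=> x; rewrite inE => /orP[/eqP->//|/mmax/le_trans]; apply; exact: ltW.
Qed.

(** Both points have maximal height on their line: a chord from [y] through a
    point [x] of [p] then goes up at most as much as the chord [y z], and a
    chord from [z] through [x] at least as much.  As both have the same slope,
    they coincide with the chord [y z]. *)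
Lemma exists_extreme_pair p q r A (S : seq 'rV[R]_2) :
  is_line p -> is_line q -> is_line r -> p <> q -> p <> r ->
  p A -> q A -> r A ->
  off S A q != [::] -> off S A r != [::] ->
  exists y z, [/\ y \in off S A q, z \in off S A r &
    forall x, x \in off S A p -> aligned y (off S A r) x ->
      aligned z (off S A q) x -> coll y z x].
Proof.
move=> lp lq lr pq pr pA qA rA q0 r0.
have [h [hx hinj]] := exists_height lp lq lr pq pr pA qA rA.
have [y yq ymax] := seq_max h q0.
have [z zr zmax] := seq_max h r0.
exists y, z; split=> // x /mem_off[_ px xA] /hasP[z' z'r c] /hasP[y' y'q c'].
have := ymax _ y'q; have := zmax _ z'r.
move: (yq) (zr) z'r y'q => /mem_off[_ qy yA] /mem_off[_ rz zA].
move=> /mem_off[_ rz' z'A] /mem_off[_ qy' y'A] hz hy.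
rewrite coll_rot collC in c'.
have e := hx x y y' z' z px xA qy yA qy' y'A rz' z'A rz zA c c'.
have ez : h z' = h z by lra.
by rewrite -(hinj z' z).
Qed.

(** * The double count *)

Lemma count_le1 (T : eqType) (a : pred T) (s : seq T) : uniq s ->
  {in s &, forall x y : T, a x -> a y -> x = y} -> (count a s <= has a s)%N.
Proof.
move=> us a1; case: hasP => [[x xs ax]|nx].
  rewrite -size_filter; apply: (@uniq_leq_size _ _ [:: x]).
    exact: filter_uniq.
  move=> y; rewrite mem_filter inE => /andP[ay ys].
  by rewrite (a1 y x).
by rewrite leqn0 -leqn0 leqNgt -has_count; apply/hasP.
Qed.

Lemma size_le_off p q r A (S : seq 'rV[R]_2) : uniq S ->
  (forall x, x \in S -> [\/ p x, q x | r x]) ->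
  (size S <= (A \in S) +
     (size (off S A p) + (size (off S A q) + size (off S A r))))%N.
Proof.
move=> uS; rewrite -(count_uniq_mem A uS) !size_filter {uS}.
elim: S => // x s IH Scases /=.
have {IH} := IH (fun f fs => Scases f (@mem_behead _ (x :: s) f fs)).
set a := count_mem _ _; set b := count _ _; set c := count _ _.
set d := count _ _.
have {Scases} := Scases x (mem_head x s).
move: a b c d => a b c d.
have [_|xA] := eqVneq x A; rewrite ?andbF ?andbT; first by lia.
by move=> [] /mem_set ->; clear; case: (x \in _); case: (x \in _); lia.
Qed.

(** The arithmetic of the proof: [a], [b], [c] points on the three lines, [e]
    for the membership of [A], [ey] and [ez] for the contributions of [q] and
    [r], and [k] for the existence of a point of [p] lost for both degrees.
    The degrees on the two sides of the disjunction add up to at least [n]. *)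
Lemma double_degree_count (n a b c my mz uy uz i : nat) (e ey ez k : bool) :
  (i <= k)%N -> (e -> ey) -> (e -> ez) -> (k -> ey || ez) ->
  (n <= e + (a + (b + c)))%N -> (my + uy = a)%N -> (mz + uz = a)%N ->
  (my + mz <= a + i)%N ->
  (uphalf n <= c + uy + ey)%N \/ (uphalf n <= b + uz + ez)%N.
Proof.
move=> ik e1 e2 k1 nle eqy eqz le.
have : (n <= (c + uy + ey) + (b + uz + ez))%N; last by lia.
have : (e + k <= ey + ez)%N.
  by case: e e1 e2 {nle}; case: k k1 {ik}; case: ey; case: ez => //= *; lia.
lia.
Qed.

(** Choosing [p] with the fewest points is what rules out the configuration of
    one point on [q], one on [r] and several on [p], one of which is aligned
    with the other two. *)
Lemma ordinary_fewest p q r A (S : seq 'rV[R]_2) : uniq S ->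
  ~ (exists L, is_line L /\ [set` S] `<=` L) ->
  is_line p -> is_line q -> is_line r -> p <> q -> p <> r -> q <> r ->
  p A -> q A -> r A -> [set` S] `<=` p `|` q `|` r ->
  (size (off S A p) <= size (off S A q))%N ->
  (size (off S A p) <= size (off S A r))%N ->
  exists P, ordinary_point (size S) [set` S] P.
Proof.
move=> uS nS lp lq lr pq pr qr pA qA rA Spqr p_q p_r.
have uoff L : uniq (off S A L) by exact: filter_uniq.
(* If [q] or [r] were empty, so would be [p], and one line would suffice. *)
have nonempty L M : is_line M -> M A ->
    (size (off S A p) <= size (off S A L))%N ->
    (forall x, x \in S -> [\/ p x, L x | M x]) -> off S A L != [::].
  move=> lM MA pL SpLM; apply/eqP => L0; apply: nS; exists M.
  split=> // x xS; have [->//|xA] := eqVneq x A.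
  have p0 : off S A p = [::].
    by apply: size0nil; move: pL; rewrite L0 leqn0 => /eqP.
  have [px|Lx|//] := SpLM _ xS.
    by suff: x \in off S A p by [rewrite p0]; apply/mem_off.
  by suff: x \in off S A L by [rewrite L0]; apply/mem_off.
have Scases x : x \in S -> [\/ p x, q x | r x].
  by move=> /Spqr[[]|]; [constructor 1|constructor 2|constructor 3].
have q0 : off S A q != [::] by apply: (nonempty q r).
have r0 : off S A r != [::].
  apply: (nonempty r q) => // x /Scases[].
  - by constructor 1.
  - by constructor 3.
  - by constructor 2.
have [y [z [yq zr yzc]]] := exists_extreme_pair lp lq lr pq pr pA qA rA q0 r0.
have dy := degree_bound uS lp lq lr pq qr pA qA rA yq.
have dz := degree_bound uS lp lr lq pr (nesym qr) pA rA qA zr.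
have [yS qy yA] := (mem_off S A q y).1 yq.
have [zS rz zA] := (mem_off S A r z).1 zr.
have yz : y != z.
  by apply: contra_not_neq qr => e; apply: (line_ext lq lr yA) => //; rewrite e.
have [L [lL Ly Lz]] := line_through yz.
move: dy dz.
set my := aligned y _; set mz := aligned z _.
set ey := has _ S; set ez := has _ S => dy dz.
set k := has (predI my mz) (off S A p).
(* Two points of [p] on the line [y z] would force [p] to be that line. *)
have kle : (count (predI my mz) (off S A p) <= k)%N.
  apply: count_le1 => // x x' xp x'p /andP[ax bx] /andP[ax' bx'].
  have /(line_coll lL Ly Lz yz) Lx := yzc _ xp ax bx.
  have /(line_coll lL Ly Lz yz) Lx' := yzc _ x'p ax' bx'.
  move: xp x'p => /mem_off[_ px _] /mem_off[_ px' _].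
  apply: contrapT => /eqP xx'; have Lp := line_ext lL lp xx' Lx Lx' px px'.
  by case/eqP: yA; apply: (line_meet lp lq) => //; rewrite -Lp.
have Ale := size_le_off A uS Scases.
have eyE : A \in S -> ey.
  by move=> AS; apply/hasP; exists A => //; rewrite (mem_set qA) eq_sym.
have ezE : A \in S -> ez.
  by move=> AS; apply/hasP; exists A => //; rewrite (mem_set rA) eq_sym.
(* If [q] and [r] contribute nothing then [S] consists of [y], [z] and one
   point of [p]; a point of [p] lost twice would make these collinear. *)
have kE : k -> ey || ez.
  move=> /hasP[x xp /andP[myx mzx]].
  have Lx : L x by apply/(line_coll lL Ly Lz yz)/yzc.
  apply: contrapT => /negP; rewrite negb_or => /andP[ny nz]; apply: nS.
  have qeq f : f \in S -> q f -> f = y.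
    move=> fS /mem_set fq; apply/eqP; apply: contraNT ny => fy.
    by apply/hasP; exists f => //; rewrite fq.
  have req f : f \in S -> r f -> f = z.
    move=> fS /mem_set fr; apply/eqP; apply: contraNT nz => fz.
    by apply/hasP; exists f => //; rewrite fr.
  have q1 : (size (off S A q) <= 1)%N.
    apply: (@uniq_leq_size _ _ [:: y]) => // f /mem_off[fS qf _].
    by rewrite inE (qeq f).
  have p1 : off S A p = [:: x].
    move: xp (leq_trans p_q q1).
    by case: (off S A p) => [//|f [|//]]; rewrite inE => /eqP->.
  exists L; split=> // f /= fS.
  have [pf|/(qeq f fS)->//|/(req f fS)->//] := Scases f fS.
  have [fA|fA] := eqVneq f A.
    by case/negP: ny; apply: eyE; rewrite -fA.
  suff : f \in off S A p by rewrite p1 inE => /eqP->.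
  exact/mem_off.
have both : (count my (off S A p) + count mz (off S A p)
    <= size (off S A p) + count (predI my mz) (off S A p))%N.
  by rewrite -count_predUI leq_add2r count_size.
have ord P m : P \in S ->
    `I_m #<= [set L | spanned_line [set` S] L /\ L P] ->
    (uphalf (size S) <= m)%N -> exists P, ordinary_point (size S) [set` S] P.
  move=> PS dP hm; exists P; split=> //; apply: card_le_trans dP.
  by rewrite card_le_II.
have [hy|hz] := double_degree_count kle eyE ezE kE Ale (count_predC my _)
  (count_predC mz _) both.
- exact: (ord y _ yS dy).
- exact: (ord z _ zS dz).
Qed.

End ThreeConcurrentLines.

Theorem theorem1 (R : realType) (n : nat) (X : set 'rV[R]_2)
    (hn : (3 <= n)%N) (cardX : X #= `I_n)
    (noncollinear : ~ exists L : set 'rV[R]_2, is_line L /\ X `<=` L)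
    (A : 'rV[R]_2) (p q r : set 'rV[R]_2)
    (line_p : is_line p) (line_q : is_line q) (line_r : is_line r)
    (neq_pq : p <> q) (neq_pr : p <> r) (neq_qr : q <> r)
    (pA : p A) (qA : q A) (rA : r A)
    (subX : X `<=` p `|` q `|` r) :
  exists P : 'rV[R]_2, ordinary_point n X P.
Proof.
have [S uS [SX Sn]] : exists2 S : seq 'rV[R]_2,
    uniq S & X = [set` S] /\ size S = n.
  exists (enum_fset (fset_set X)); first exact: fset_uniq.
  split; last exact: card_fset_set.
  by rewrite fset_setK//; exists n.
rewrite {}SX in noncollinear subX *.
rewrite -Sn.
have [p_q|/ltnW q_p] := leqP (size (off S A p)) (size (off S A q)).
  have [p_r|/ltnW r_p] := leqP (size (off S A p)) (size (off S A r)).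
    exact: (@ordinary_fewest _ p q r A).
  have r_q := leq_trans r_p p_q.
  apply: (@ordinary_fewest _ r p q A) => //; try exact: nesym.
  by move=> x /subX [[]|]; [left;right|right|left;left].
have [q_r|/ltnW r_q] := leqP (size (off S A q)) (size (off S A r)).
  apply: (@ordinary_fewest _ q p r A) => //; try exact: nesym.
  by move=> x /subX [[]|]; [left;right|left;left|right].
have r_p := leq_trans r_q q_p.
apply: (@ordinary_fewest _ r p q A) => //; try exact: nesym.
by move=> x /subX [[]|]; [left;right|right|left;left].
Qed.
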